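(* Let $\Gamma$ be any multivision game, with associated consecutive primes $p_j<\dots<p_{j+k}$. Then every play of $\Gamma$ terminates after finitely many moves. Moreover, for any position $u$ of $\Gamma$, with $M_u=\prod_{i=j}^{j+k}p_i^{s_i}$ (where the $s_i$ are nonnegative integers), play at $u$ can be prolonged arbitrarily long (that is, for every positive integer $r$ there is a sequence of at least $r$ consecutive legal moves starting from $u$) if and only if $M_u$ has a prime factor different from $p_{j+k}$.
   Context: Let $p_1=2,p_2=3,p_3=5,\dots$ be the increasing sequence of all primes. A multivision game $\Gamma$ is a two-player game, the players moving alternately, specified by an initial position consisting of $m$ piles of tokens of sizes $n_1,\dots,n_m$ (positive integers). Put $M=M_\Gamma=\prod_{i=1}^m n_i$, and let $M>1$. Let $p_j$ be the smallest and $p_{j+k}$ the largest prime dividing the initial product $M_\Gamma$, with $k>0$; these are fixed throughout the game, and the primes $p_j<p_{j+1}<\dots<p_{j+k}$ are consecutive primes (an intermediate prime need not divide $M_\Gamma$). A move: the player selects a pile of size $n_i>1$ and a prime $p_h$ dividing $n_i$, and replaces $n_i$ by $\frac{n_i}{p_h}\prod_{l=h+1}^{j+k}p_l^{t_l}$, where the $t_l$ are arbitrary nonnegative integers chosen by the player (the product is $1$ if $h=j+k$); the other piles are unchanged. The positions of $\Gamma$ are the tuples of pile sizes that can arise in play, including the initial one. For a position $u$, $M_u$ denotes the product of the pile sizes in $u$. Play terminates when all piles have size $1$ (equivalently $M_u=1$), since no move is then possible; the player reaching this position wins and the opponent loses. *)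

(* Defs.v *)
From mathcomp Require Import all_boot.

Set Implicit Arguments.
Unset Strict Implicit.
Unset Printing Implicit Defensive.

Lemma exists_prime_gt (n : nat) : exists p, (n < p) && prime p.
Proof. by have [p n_lt_p p_pr] := prime_above n; exists p; rewrite n_lt_p. Qed.

Definition next_prime (n : nat) : nat := ex_minn (exists_prime_gt n).

(* The primes are numbered from 1: nth_prime 1 = 2, nth_prime 2 = 3, ...
   The value nth_prime 0 = 1 is a placeholder and is not a prime. *)
Definition nth_prime (i : nat) : nat := iter i next_prime 1.

Definition pile_product (m : nat) (u : {ffun 'I_m -> nat}) : nat :=
  \prod_(i < m) u i.

(* lo and gap are the integers j and k such that p_j and p_(j+k) are the
   smallest and largest primes dividing the initial product; they are
   determined by the initial position. *)
Record multivision := Multivision {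
  npiles : nat;
  start : {ffun 'I_npiles -> nat};
  lo : nat;
  gap : nat;
  start_pos : forall i, 0 < start i;
  start_product_gt1 : 1 < pile_product start;
  lo_smallest : pdiv (pile_product start) = nth_prime lo;
  hi_largest : max_pdiv (pile_product start) = nth_prime (lo + gap);
  gap_gt0 : 0 < gap
}.

Section Play.

Variable G : multivision.

Definition piles := {ffun 'I_(npiles G) -> nat}.

Definition move (u v : piles) : Prop :=
  exists (i : 'I_(npiles G)) (h : nat) (t : nat -> nat),
    [/\ 1 < u i, prime (nth_prime h), nth_prime h %| u i &
        v = [ffun i' => if i' == i
                        then u i %/ nth_prime h *
                             \prod_(h.+1 <= l < (lo G + gap G).+1)
                                nth_prime l ^ t l
                        else u i']].

(* The first r steps of w are legal moves; w is unconstrained afterwards. *)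
Definition legal_moves (r : nat) (w : nat -> piles) : Prop :=
  forall i, i < r -> move (w i) (w i.+1).

Definition is_position (u : piles) : Prop :=
  exists (r : nat) (w : nat -> piles),
    [/\ w 0 = start G, legal_moves r w & w r = u].

Definition infinite_play (w : nat -> piles) : Prop :=
  w 0 = start G /\ forall i, move (w i) (w i.+1).

Definition arbitrarily_long_from (u : piles) : Prop :=
  forall r, 0 < r ->
    exists (r' : nat) (w : nat -> piles),
      [/\ r <= r', w 0 = u & legal_moves r' w].

End Play.

(* Main.v *)
Require Import Defs.
From mathcomp Require Import all_boot.

(** A move at the prime [p_h] divides the product of all piles by [p_h] and
    multiplies it by some product of powers of the larger primes
    [p_(h+1), ..., p_(j+k)] ([move_product]).  In particular the prime factors
    of the product stay among [p_j, ..., p_(j+k)], which gives the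
    factorisation of [M_u] ([position_supported], [supported_factor]).

    Termination: list the exponents of [p_1, ..., p_(j+k)] in the product,
    smaller primes first.  A move at [p_h] leaves the entries before the
    h-th one unchanged and lowers the h-th one by one, so the lists of exponents
    descend in the lexicographic order, and this order has no infinite descent
    on lists of bounded length ([no_lex_descent]).

    Length of plays: if [M_u = p_(j+k)^n], the only possible moves divide the
    product by [p_(j+k)], so at most [n] moves remain ([top_power_play]).  If
    some other prime divides [M_u], it divides a pile, and one move at this
    prime can put [p_(j+k)^r] into that pile; removing the [r] factors
    [p_(j+k)] one at a time then takes [r] further moves
    ([top_factor_play]). *)

(** * The enumeration of primes *)

Lemma next_prime_gt n : n < next_prime n.
Proof. by rewrite /next_prime; case: ex_minnP => p /andP[]. Qed.

Lemma prime_next_prime n : prime (next_prime n).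
Proof. by rewrite /next_prime; case: ex_minnP => p /andP[]. Qed.

Lemma next_prime_le n q : prime q -> n < q -> next_prime n <= q.
Proof.
move=> q_pr n_lt_q; rewrite /next_prime; case: ex_minnP => p _.
by apply; rewrite n_lt_q.
Qed.

Lemma prime_nth_prime i : 0 < i -> prime (nth_prime i).
Proof. by case: i => // i _; apply: prime_next_prime. Qed.

Lemma prime_nth_prime_gt0 i : prime (nth_prime i) -> 0 < i.
Proof. by case: i. Qed.

Lemma nth_prime_gt0 i : 0 < nth_prime i.
Proof. by case: i => // i; rewrite prime_gt0 ?prime_nth_prime. Qed.

Lemma ltn_nth_prime : {mono nth_prime : i j / i < j}.
Proof.
apply: leqW_mono; apply: leq_mono; apply: (homo_ltn ltn_trans) => i.
exact: next_prime_gt.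
Qed.

Lemma leq_nth_prime : {mono nth_prime : i j / i <= j}.
Proof. by move=> i j; rewrite leqNgt ltn_nth_prime -leqNgt. Qed.

Lemma nth_prime_inj : injective nth_prime.
Proof.
move=> i j eq_ij; apply/eqP.
by rewrite eqn_leq -(leq_nth_prime i) -(leq_nth_prime j) eq_ij leqnn.
Qed.

(** The least [i] with [q <= p_i] works: [p_(i-1) < q <= p_i], and [p_i] is the
    least prime above [p_(i-1)]. *)
Lemma nth_prime_surj q : prime q -> exists i, q = nth_prime i.
Proof.
move=> q_pr; have q_bound : exists i, q <= nth_prime i.
  exists q; elim: (q) => // i IHi; exact: leq_ltn_trans IHi (next_prime_gt _).
case: (ex_minnP q_bound) => -[|i] q_le min_i.
  by rewrite leqNgt prime_gt1 in q_le.
exists i.+1; apply/eqP; rewrite eqn_leq q_le next_prime_le // ltnNge.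
by apply/negP => /min_i; rewrite ltnn.
Qed.

Lemma logn_nth_prime i j :
  logn (nth_prime i) (nth_prime j) = (0 < j) && (i == j).
Proof.
case: j => [|j]; first by rewrite logn1.
by rewrite (logn_prime _ (prime_nth_prime _ (ltn0Sn j))) (inj_eq nth_prime_inj).
Qed.

Lemma prod_nth_prime_gt0 a b t : 0 < \prod_(a <= l < b) nth_prime l ^ t l.
Proof. by apply: prodn_gt0 => l; rewrite expn_gt0 nth_prime_gt0. Qed.

Lemma logn_prod_nth_prime a b t i : 0 < a ->
  logn (nth_prime i) (\prod_(a <= l < b) nth_prime l ^ t l) =
  if a <= i < b then t i else 0.
Proof.
move=> a_gt0; elim: b => [|b IHb]; first by rewrite big_geq // logn1 ltn0 andbF.
have [le_ab|lt_ba] := leqP a b; last first.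
  rewrite big_geq // logn1; case: ifP => // /andP[le_ai le_ib].
  by move: (leq_trans (leq_trans lt_ba le_ai) (le_ib : i <= b)); rewrite ltnn.
rewrite big_nat_recr //= lognM ?prod_nth_prime_gt0 ?expn_gt0 ?nth_prime_gt0 //.
rewrite IHb lognX logn_nth_prime (leq_trans a_gt0 le_ab) ltnS /=.
by case: ltngtP => [||->]; rewrite ?muln0 ?muln1 ?addn0 ?le_ab ?andbF //.
Qed.

Lemma prime_dvd_prod_nth_prime a b t q : prime q -> 0 < a ->
    q %| \prod_(a <= l < b) nth_prime l ^ t l ->
  exists2 l, a <= l < b & q = nth_prime l.
Proof.
move=> q_pr a_gt0 q_dvd; have [i def_q] := nth_prime_surj _ q_pr.
exists i => //; move: q_dvd; apply: contraTT => i_out.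
rewrite -[q]expn1 pfactor_dvdn ?prod_nth_prime_gt0 //.
by rewrite def_q logn_prod_nth_prime // (negPf i_out).
Qed.

(** * Infinite lexicographic descent *)

(** Induction on the number [d] of coordinates, then on the first coordinate:
    the latter never increases, and it can never decrease since the descent
    that starts after its first decrease is excluded by induction.  It is thus
    constant, and the remaining coordinates form a descent on their own. *)
Lemma no_lex_descent d (e : nat -> nat -> nat) :
  ~ forall n, exists2 h, h < d &
      e n.+1 h < e n h /\ forall l, l < h -> e n.+1 l = e n l.
Proof.
elim: d e => [e /(_ 0)[] // | d IHd e].
have [c] := ubnP (e 0 0); elim: c e => // c IHc e e00_le desc.
have e_noninc n : e n 0 <= e 0 0.
  elim: n => // n /(leq_trans _); apply.
  by have [[|h] _ [lt_e eq_e]] := desc n; [apply: ltnW | rewrite eq_e].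
apply: (IHd (fun n l => e n l.+1)) => n.
have [[|h] lt_hd [lt_e eq_e]] := desc n; last first.
  by exists h => //; split=> // l lt_lh; apply: eq_e.
case: (IHc (fun m => e (n.+1 + m))) => [|m].
  by rewrite addn0 (leq_trans lt_e) // (leq_trans (e_noninc n)).
by rewrite addnS; apply: desc.
Qed.

(** * The product of the piles *)

Section Game.

Variable G : multivision.
Implicit Types u v : piles G.

Local Notation hi := (lo G + gap G).
Local Notation reward h t := (\prod_(h.+1 <= l < hi.+1) nth_prime l ^ t l).

Lemma lo_gt0 : 0 < lo G.
Proof.
by rewrite prime_nth_prime_gt0 // -lo_smallest pdiv_prime ?start_product_gt1.
Qed.

Lemma lo_lt_hi : lo G < hi.
Proof. by rewrite -addn1 leq_add2l gap_gt0. Qed.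

Lemma prime_hi : prime (nth_prime hi).
Proof. by rewrite prime_nth_prime // (ltn_trans lo_gt0 lo_lt_hi). Qed.

(** Multiplying by [p_h], rather than dividing by it, keeps the effect of a move
    on the product free of truncated division, so that it can be read off prime
    by prime. *)
Lemma move_product u v : move u v ->
  exists h t, [/\ 0 < h, nth_prime h %| pile_product u &
    pile_product v * nth_prime h = pile_product u * reward h t].
Proof.
move=> [i [h [t [_ h_pr h_dvd ->]]]]; exists h, t.
split; first exact: prime_nth_prime_gt0.
  by rewrite /pile_product (bigD1 i) //= dvdn_mulr.
rewrite /pile_product !(bigD1 (P := xpredT) i) //= ffunE eqxx.
rewrite (eq_bigr u) => [|i' /negPf ne_i'i]; last by rewrite ffunE ne_i'i.
rewrite -[in RHS](divnK h_dvd) -!mulnA; congr (_ * _).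
by rewrite mulnA mulnC; congr (_ * _); apply: mulnC.
Qed.

(** The invariant of play: it holds at the start and is preserved by moves.
    Positivity is part of it because every prime divides 0. *)
Definition supported u :=
  0 < pile_product u /\
  forall q, prime q -> q %| pile_product u ->
    exists2 l, lo G <= l <= hi & q = nth_prime l.

Lemma start_supported : supported (start G).
Proof.
have M_gt1 := start_product_gt1 G; split=> [|q q_pr q_dvd]; first exact: ltnW.
have [l def_q] := nth_prime_surj _ q_pr; exists l => //.
rewrite -(leq_nth_prime (lo G)) -(leq_nth_prime l) -lo_smallest.
rewrite -hi_largest -def_q.
rewrite pdiv_min_dvd ?prime_gt1 //= max_pdiv_max //.
by rewrite mem_primes q_pr q_dvd ltnW.
Qed.

Lemma move_supported u v : supported u -> move u v -> supported v.
Proof.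
move=> [Mu_gt0 supp_u] /move_product[h [t [h_gt0 h_dvd eq_M]]].
have [l lohi_l /nth_prime_inj def_h] :=
  supp_u _ (prime_nth_prime _ h_gt0) h_dvd.
subst l; have /andP[lo_h h_hi] := lohi_l; split=> [|q q_pr q_dvd].
  have: 0 < pile_product u * reward h t.
    by rewrite muln_gt0 Mu_gt0 prod_nth_prime_gt0.
  by rewrite -eq_M muln_gt0 => /andP[].
have: q %| pile_product u * reward h t by rewrite -eq_M dvdn_mulr.
rewrite Euclid_dvdM // => /orP[|q_dvd_reward]; first exact: supp_u.
have [//|l /andP[lt_hl l_hi] ->] :=
  prime_dvd_prod_nth_prime _ _ _ _ q_pr _ q_dvd_reward.
exists l => //.
by rewrite (leq_trans lo_h (ltnW lt_hl)).
Qed.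

Lemma legal_moves_supported r w :
  w 0 = start G -> legal_moves r w -> supported (w r).
Proof.
move=> w0 w_legal; suffices: forall n, n <= r -> supported (w n) by apply.
elim=> [_|n IHn lt_nr]; first by rewrite w0; apply: start_supported.
by apply: move_supported (IHn (ltnW lt_nr)) (w_legal n lt_nr).
Qed.

Lemma position_supported u : is_position u -> supported u.
Proof. by move=> [r [w [w0 w_legal <-]]]; apply: legal_moves_supported. Qed.

Lemma supported_factor u : supported u ->
  pile_product u =
    \prod_(lo G <= i < hi.+1) nth_prime i ^ logn (nth_prime i) (pile_product u).
Proof.
move=> [Mu_gt0 supp_u]; apply: eqn_from_log => //.
  exact: prod_nth_prime_gt0.
move=> q.
have [q_pr|q_npr] := boolP (prime q); last first.
  by rewrite lognE [RHS]lognE (negPf q_npr).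
have [i def_q] := nth_prime_surj _ q_pr.
rewrite [in RHS]def_q logn_prod_nth_prime ?lo_gt0 // -def_q.
case: ifPn => // i_out; apply/eqP; rewrite -leqn0 leqNgt logn_gt0 mem_primes.
apply/negP => /and3P[_ _ /(supp_u _ q_pr)[l l_in]].
by rewrite def_q => /nth_prime_inj def_i; rewrite def_i ltnS l_in in i_out.
Qed.

(** * Termination *)

(** The primes gained in a move at [p_h] are all larger than [p_h], so up to
    index [h] the only change of an exponent is the loss of one [p_h].  The
    coordinate of index 0, which belongs to the placeholder 1, is always 0. *)
Lemma move_lex_descent u v : supported u -> move u v ->
  exists2 h, h < hi.+1 &
    logn (nth_prime h) (pile_product v) < logn (nth_prime h) (pile_product u) /\
    forall l, l < h ->
      logn (nth_prime l) (pile_product v) = logn (nth_prime l) (pile_product u).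
Proof.
move=> supp_u mv_uv; have [Mv_gt0 _] := move_supported _ _ supp_u mv_uv.
have [Mu_gt0 dvd_u] := supp_u.
have [h [t [h_gt0 h_dvd eq_M]]] := move_product _ _ mv_uv.
exists h.
  have [l /andP[_ l_hi]] := dvd_u _ (prime_nth_prime _ h_gt0) h_dvd.
  by move/nth_prime_inj->.
have log_move l : l <= h ->
    logn (nth_prime l) (pile_product v) + (l == h) =
    logn (nth_prime l) (pile_product u).
  move=> le_lh; have := congr1 (logn (nth_prime l)) eq_M.
  rewrite !lognM ?prod_nth_prime_gt0 ?nth_prime_gt0 // logn_nth_prime h_gt0 /=.
  by rewrite logn_prod_nth_prime // [h < l]ltnNge le_lh addn0.
split=> [|l lt_lh]; first by rewrite -log_move // eqxx addn1.
by rewrite -log_move ?(ltnW lt_lh) // (ltn_eqF lt_lh) addn0.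
Qed.

Lemma no_infinite_play w : ~ @infinite_play G w.
Proof.
move=> [w0 w_play]; apply: (no_lex_descent hi.+1
  (fun n l => logn (nth_prime l) (pile_product (w n)))) => n.
by apply: move_lex_descent => //; apply: legal_moves_supported => // i _.
Qed.

(** * Lengths of plays from a position *)

(** Only moves at the largest prime are possible, and such a move gains no
    primes: the exponent [n] counts down by one at each move. *)
Lemma top_power_play n r w :
    pile_product (w 0) = nth_prime hi ^ n -> @legal_moves G r w -> r <= n.
Proof.
elim: r n w => // r IHr n w M0 w_legal.
have [h [t [h_gt0 h_dvd]]] := move_product _ _ (w_legal 0 (ltn0Sn r)).
move: h_dvd; rewrite M0 => h_dvd.
have hi_h : h = hi.
  apply: nth_prime_inj; apply/eqP.
  rewrite -dvdn_prime2 ?prime_hi ?prime_nth_prime //.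
  by move: h_dvd; rewrite Euclid_dvdX ?prime_nth_prime // => /andP[].
rewrite hi_h big_geq // muln1.
case: n M0 h_dvd => [|n] M0 h_dvd M1.
  by move: h_dvd prime_hi; rewrite dvdn1 hi_h => /eqP->.
move: M1; rewrite expnSr => /eqP.
rewrite eqn_pmul2r ?nth_prime_gt0 // => /eqP M1.
apply: (IHr n (fun i => w i.+1)) => // i lt_ir; exact: w_legal.
Qed.

Lemma legal_moves_cons r u v w : move u v -> w 0 = v -> legal_moves r w ->
  exists w' : nat -> piles G, w' 0 = u /\ legal_moves r.+1 w'.
Proof.
move=> mv_uv w0 w_legal; exists (fun n => if n is n'.+1 then w n' else u).
by split=> // -[_|n]; [rewrite w0 | apply: w_legal].
Qed.

(** A factor [p_(j+k)] can always be cancelled without any compensation. *)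
Lemma top_factor_play r u i : 0 < u i -> nth_prime hi ^ r %| u i ->
  exists w : nat -> piles G, w 0 = u /\ legal_moves r w.
Proof.
elim: r u => [|r IHr] u ui_gt0 dvd_ui; first by exists (fun=> u); split.
have hi_dvd : nth_prime hi %| u i.
  by apply: dvdn_trans dvd_ui; rewrite expnS dvdn_mulr.
pose v : piles G := [ffun i' => if i' == i then u i %/ nth_prime hi else u i'].
have vi : v i = u i %/ nth_prime hi by rewrite ffunE eqxx.
have mv_uv : move u v.
  exists i, hi, (fun=> 0); split=> //; last by rewrite big_geq // muln1.
    by apply: leq_trans (dvdn_leq ui_gt0 hi_dvd); rewrite prime_gt1 ?prime_hi.
  exact: prime_hi.
have [||w [w0 w_legal]] := IHr v.
- by rewrite vi divn_gt0 ?nth_prime_gt0 // dvdn_leq.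
- by rewrite vi dvdn_divRL // -expnSr.
exact: legal_moves_cons mv_uv w0 w_legal.
Qed.

(** Since [q = p_h] with [h < j+k], a move at [q] may bring in the factor
    [p_(j+k)^r], which is then cancelled in [r] moves. *)
Lemma non_top_factor_arbitrarily_long u q : supported u ->
    prime q -> q %| pile_product u -> q <> nth_prime hi ->
  arbitrarily_long_from u.
Proof.
move=> [Mu_gt0 supp_u] q_pr q_dvd q_ne r _.
have [h /andP[lo_h h_hi] def_q] := supp_u q q_pr q_dvd; subst q.
have lt_h_hi : h < hi.
  by rewrite ltn_neqAle h_hi andbT; apply/eqP => def_h; rewrite def_h in q_ne.
have [i h_dvd] : exists i, nth_prime h %| u i.
  apply/existsP; move: q_dvd; apply: contraLR.
  rewrite negb_exists => /forallP ndvd.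
  rewrite /pile_product; elim/big_rec: _ => [|i x _].
    by rewrite dvdn1 neq_ltn prime_gt1 ?orbT.
  by rewrite Euclid_dvdM // negb_or ndvd.
have ui_gt0 : 0 < u i.
  by move: Mu_gt0; rewrite /pile_product (bigD1 i) //= muln_gt0 => /andP[].
(* [hi] lies in the range of the reward because [h < hi]. *)
pose t l := if l == hi then r else 0.
pose v : piles G := [ffun i' =>
  if i' == i then u i %/ nth_prime h * reward h t else u i'].
have mv_uv : move u v.
  exists i, h, t; split=> //.
  by apply: leq_trans (dvdn_leq ui_gt0 h_dvd); rewrite prime_gt1.
have vi : v i = u i %/ nth_prime h * reward h t by rewrite ffunE eqxx.
have [||w [w0 w_legal]] := top_factor_play r v i.
- rewrite vi muln_gt0 prod_nth_prime_gt0 andbT.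
  by rewrite divn_gt0 ?nth_prime_gt0 // dvdn_leq.
- by rewrite vi big_nat_recr //= /t eqxx mulnA dvdn_mull.
have [w' [w'0 w'_legal]] := legal_moves_cons r u v w mv_uv w0 w_legal.
by exists r.+1, w'.
Qed.

(** Otherwise the product is a power of the largest prime, and its exponent
    bounds the length of every play. *)
Lemma arbitrarily_long_non_top_factor u : 0 < pile_product u ->
    arbitrarily_long_from u ->
  exists q, [/\ prime q, q %| pile_product u & q <> nth_prime hi].
Proof.
move=> Mu_gt0 long_u.
have [top|] := boolP ((nth_prime hi).-nat (pile_product u)).
  have [n Mu] := p_natP top.
  have [r [w [lt_nr w0 w_legal]]] := long_u n.+1 (ltn0Sn n).
  have := top_power_play n r w; rewrite w0 leqNgt lt_nr => /(_ Mu w_legal) //.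
rewrite /pnat Mu_gt0 => /allPn[q]; rewrite mem_primes => /and3P[q_pr _ q_dvd].
by rewrite inE => /eqP q_ne; exists q.
Qed.

End Game.

Theorem theorem1 (G : multivision) :
  (~ exists w : nat -> piles G, infinite_play w) /\
  (forall u : piles G, is_position u ->
     (exists s : nat -> nat,
        pile_product u =
          \prod_(lo G <= i < (lo G + gap G).+1) nth_prime i ^ s i) /\
     (arbitrarily_long_from u <->
        exists q : nat,
          [/\ prime q, q %| pile_product u & q <> nth_prime (lo G + gap G)])).
Proof.
split=> [[w]|u /position_supported supp_u]; first exact: no_infinite_play.
split; last split=> [|[q [q_pr q_dvd q_ne]]].
- exists (fun i => logn (nth_prime i) (pile_product u)).
  exact: supported_factor.
- by apply: arbitrarily_long_non_top_factor; case: supp_u.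
- exact: non_top_factor_arbitrarily_long q_dvd q_ne.
Qed.
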